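(* Let $\mathcal I$ be a tensor ideal of $\mathcal T$ satisfying the standing assumption in the context, and let $z_1,z_2\in\mathbb Q(q)$ be the scalars for which $\sigma_+-\sigma_-=z_1(1_2-\mathsf U)+z_2(\mathsf H-\mathsf N)$ in $\mathcal T/\mathcal I$. If $z_1=z_2$, then in $\mathcal T/\mathcal I$ $$\mathsf X_+=\frac{[2]}{[4]}\left(q^{-8}1_2+q^8\mathsf U+\sigma_+\right)-q^{-2}\mathsf H-q^2\mathsf N,$$ $$\mathsf X_-=\frac{[2]}{[4]}\left(q^{8}1_2+q^{-8}\mathsf U+\sigma_-\right)-q^{2}\mathsf H-q^{-2}\mathsf N.$$
   Context: $[n]=\frac{q^n-q^{-n}}{q-q^{-1}}$. **Monoidal notation.** $\mathbb 1$ is the unit object, morphisms compose right to left ($fg=f\circ g$), $1$ denotes the identity of the object $\mathsf I$, and $1_n$ the identity of $\mathsf I^{\otimes n}$. (String diagrams are read bottom to top; $m$ is a trivalent merge; $\sigma_+$ is the crossing in which the strand from bottom left to top right passes over, $\sigma_-$ the opposite crossing.) **The category $\mathcal T$.** Let $\Bbbk=\mathbb Q(q)$, $\tau=q^{12}$, $\beta=q^{24}$, and let $\delta\in\Bbbk$, $\phi\in\Bbbk^\times$ be arbitrary. $\mathcal T$ is the strict $\Bbbk$-linear monoidal category generated by one object $\mathsf I$ and morphisms $m:\mathsf I^{\otimes2}\to\mathsf I$, $\sigma_+,\sigma_-:\mathsf I^{\otimes 2}\to\mathsf I^{\otimes2}$, $\cup:\mathbb1\to\mathsf I^{\otimes2}$,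 $\cap:\mathsf I^{\otimes2}\to\mathbb1$, subject to: (R1) $(\cap\otimes1)(1\otimes\cup)=1=(1\otimes\cap)(\cup\otimes1)$; (R2) $(1\otimes m)(\cup\otimes1)=(m\otimes1)(1\otimes\cup)$; this common morphism $\mathsf I\to\mathsf I^{\otimes2}$ is denoted $s$; (R3) $(1\otimes\cap)(\sigma_-\otimes1)=(\cap\otimes1)(1\otimes\sigma_+)$ and $(1\otimes\cap)(\sigma_+\otimes1)=(\cap\otimes1)(1\otimes\sigma_-)$; (R4) $\sigma_-\sigma_+=1_2=\sigma_+\sigma_-$; (R5) $(\sigma_+\otimes1)(1\otimes\sigma_+)(\sigma_+\otimes1)=(1\otimes\sigma_+)(\sigma_+\otimes1)(1\otimes\sigma_+)$; (R6) $(1\otimes m)(\sigma_+\otimes1)(1\otimes\sigma_+)=\sigma_+(m\otimes1)$; (R7) $(1\otimes\sigma_+)(\sigma_+\otimes1)(1\otimes s)=(s\otimes1)\sigma_+$; (R8) $\cap\sigma_+=\beta\cap$, $m\sigma_+=\tau m$, $ms=\phi 1$, $\cap\cup=\delta1_{\mathbb1}$, $m\cup=0$. Put $\mathsf U=\cup\cap$, $\mathsf H=(m\otimes1)(1\otimes s)=(1\otimes m)(s\otimes1)$, $\mathsf N=sm$, $\mathsf X_+=q^6(m\otimes1)(1\otimes\sigma_+)(s\otimes1)$, $\mathsf X_-=q^{-6}(m\otimes1)(1\otimes\sigma_-)(s\otimes1)$. **Standing assumption.** $\delta\notin\{q^4+q^{-4},\,-q^{16}-q^{-16}\}$, and $\mathcal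 I$ is a tensor ideal of $\mathcal T$ such that $1_2,\ \mathsf U,\ \mathsf H,\ \mathsf N,\ \sigma_++\sigma_-$ form a $\Bbbk$-basis of $(\mathcal T/\mathcal I)(\mathsf I^{\otimes2},\mathsf I^{\otimes2})$. The same symbols denote morphisms of $\mathcal T$ and their images in $\mathcal T/\mathcal I$. (Under this assumption scalars $z_1,z_2$ as in the claim exist and are unique.) *)

(* Defs.v *)
From HB Require Import structures.
From mathcomp Require Import all_boot all_algebra boolp.

Set Implicit Arguments.
Unset Strict Implicit.
Unset Printing Implicit Defensive.

Import GRing.Theory.
Local Open Scope ring_scope.
Local Open Scope quotient_scope.

Reserved Notation "f ∘ g" (at level 40, left associativity).
Reserved Notation "f ⊗ g" (at level 38, left associativity).

(* Transport along equalities of natural numbers.  The associativity and right *)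
(* unit laws of a strict tensor product are only well typed up to the equations *)
(* (a + b) + c = a + (b + c) and a + 0 = a.                                     *)
Definition castm (X : nat -> nat -> Type) a a' b b'
    (ea : a = a') (eb : b = b') (f : X a b) : X a' b' :=
  ecast i (X i b') ea (ecast j (X a j) eb f).

(* Strict K-linear monoidal categories generated on objects by one object I:   *)
(* the objects are the tensor powers of I, with n standing for its n-th power, *)
(* so that 0 is the unit object and the tensor product of objects is addition. *)
Record linmoncat (K : fieldType) := LinMonCat {
  mhom : nat -> nat -> lmodType K;
  idm : forall n, mhom n n;
  mcomp : forall a b c, mhom b c -> mhom a b -> mhom a c;
  mtens : forall a b c d, mhom a b -> mhom c d -> mhom (a + c)%N (b + d)%N;
  mcomp1m : forall a b (f : mhom a b), mcomp (idm b) f = f;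
  mcompm1 : forall a b (f : mhom a b), mcomp f (idm a) = f;
  mcompA : forall a b c d (f : mhom c d) (g : mhom b c) (h : mhom a b),
    mcomp f (mcomp g h) = mcomp (mcomp f g) h;
  mcompPl : forall a b c k (f f' : mhom b c) (g : mhom a b),
    mcomp (k *: f + f') g = k *: mcomp f g + mcomp f' g;
  mcompPr : forall a b c k (f : mhom b c) (g g' : mhom a b),
    mcomp f (k *: g + g') = k *: mcomp f g + mcomp f g';
  mtensPl : forall a b c d k (f f' : mhom a b) (g : mhom c d),
    mtens (k *: f + f') g = k *: mtens f g + mtens f' g;
  mtensPr : forall a b c d k (f : mhom a b) (g g' : mhom c d),
    mtens f (k *: g + g') = k *: mtens f g + mtens f g';
  mtens_idm : forall a b, mtens (idm a) (idm b) = idm (a + b)%N;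
  mtens_comp : forall a b c a' b' c'
      (f : mhom b c) (g : mhom a b) (f' : mhom b' c') (g' : mhom a' b'),
    mtens (mcomp f g) (mcomp f' g') = mcomp (mtens f f') (mtens g g');
  mtens1m : forall a b (f : mhom a b), mtens (idm 0) f = f;
  mtensm1 : forall a b (f : mhom a b),
    castm (X := mhom) (addn0 a) (addn0 b) (mtens f (idm 0)) = f;
  mtensA : forall a b c a' b' c' (f : mhom a a') (g : mhom b b') (h : mhom c c'),
    castm (X := mhom) (addnA a b c) (addnA a' b' c') (mtens f (mtens g h))
      = mtens (mtens f g) h
}.

Arguments mcomp {K _ a b c}.
Arguments mtens {K _ a b c d}.
Arguments idm {K _} n.

Declare Scope mor_scope.
Delimit Scope mor_scope with mor.
Notation "f ∘ g" := (mcomp f g) : mor_scope.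
Notation "f ⊗ g" := (mtens f g) : mor_scope.

(* Keeps unification from unfolding the operations of the quotients below to   *)
(* canonical representatives.                                                  *)
Fact quot_key : unit. Proof. exact: tt. Qed.
Local Notation lock := (locked_with quot_key).

Section Presentation.
Variables (K : fieldType) (G : nat -> nat -> Type).

Inductive term : nat -> nat -> Type :=
  | Gen a b of G a b : term a b
  | Idt n : term n n
  | Comp a b c of term b c & term a b : term a c
  | Tens a b c d of term a b & term c d : term (a + c) (b + d)
  | Zero a b : term a b
  | Add a b of term a b & term a b : term a b
  | Scale a b of K & term a b : term a b.

Variable rel : forall a b, term a b -> term a b -> Prop.

(* The smallest congruence containing rel and the axioms of a strict K-linear *)
(* monoidal category.                                                         *)
Inductive teq : forall a b, term a b -> term a b -> Prop :=
  | teq_rel a b (x y : term a b) : rel x y -> teq x y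
  | teq_refl a b (x : term a b) : teq x x
  | teq_sym a b (x y : term a b) : teq x y -> teq y x
  | teq_trans a b (x y z : term a b) : teq x y -> teq y z -> teq x z
  | teq_comp a b c (x x' : term b c) (y y' : term a b) :
      teq x x' -> teq y y' -> teq (Comp x y) (Comp x' y')
  | teq_tens a b c d (x x' : term a b) (y y' : term c d) :
      teq x x' -> teq y y' -> teq (Tens x y) (Tens x' y')
  | teq_add a b (x x' y y' : term a b) :
      teq x x' -> teq y y' -> teq (Add x y) (Add x' y')
  | teq_scale a b k (x x' : term a b) :
      teq x x' -> teq (Scale k x) (Scale k x')
  | teq_addA a b (x y z : term a b) : teq (Add x (Add y z)) (Add (Add x y) z)
  | teq_addC a b (x y : term a b) : teq (Add x y) (Add y x)
  | teq_add0 a b (x : term a b) : teq (Add (Zero a b) x) x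
  | teq_addN a b (x : term a b) : teq (Add (Scale (-1) x) x) (Zero a b)
  | teq_scaleA a b k l (x : term a b) :
      teq (Scale k (Scale l x)) (Scale (k * l) x)
  | teq_scale1 a b (x : term a b) : teq (Scale 1 x) x
  | teq_scaleDr a b k (x y : term a b) :
      teq (Scale k (Add x y)) (Add (Scale k x) (Scale k y))
  | teq_scaleDl a b k l (x : term a b) :
      teq (Scale (k + l) x) (Add (Scale k x) (Scale l x))
  | teq_comp1m a b (x : term a b) : teq (Comp (Idt b) x) x
  | teq_compm1 a b (x : term a b) : teq (Comp x (Idt a)) x
  | teq_compA a b c d (x : term c d) (y : term b c) (z : term a b) :
      teq (Comp x (Comp y z)) (Comp (Comp x y) z)
  | teq_compPl a b c k (x x' : term b c) (y : term a b) :
      teq (Comp (Add (Scale k x) x') y) (Add (Scale k (Comp x y)) (Comp x' y))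
  | teq_compPr a b c k (x : term b c) (y y' : term a b) :
      teq (Comp x (Add (Scale k y) y')) (Add (Scale k (Comp x y)) (Comp x y'))
  | teq_tensPl a b c d k (x x' : term a b) (y : term c d) :
      teq (Tens (Add (Scale k x) x') y) (Add (Scale k (Tens x y)) (Tens x' y))
  | teq_tensPr a b c d k (x : term a b) (y y' : term c d) :
      teq (Tens x (Add (Scale k y) y')) (Add (Scale k (Tens x y)) (Tens x y'))
  | teq_tens_idm a b : teq (Tens (Idt a) (Idt b)) (Idt (a + b))
  | teq_tens_comp a b c a' b' c'
      (x : term b c) (y : term a b) (x' : term b' c') (y' : term a' b') :
      teq (Tens (Comp x y) (Comp x' y')) (Comp (Tens x x') (Tens y y'))
  | teq_tens1m a b (x : term a b) : teq (Tens (Idt 0) x) x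
  | teq_tensm1 a b (x : term a b) :
      teq (castm (addn0 a) (addn0 b) (Tens x (Idt 0))) x
  | teq_tensA a b c a' b' c' (x : term a a') (y : term b b') (z : term c c') :
      teq (castm (addnA a b c) (addnA a' b' c') (Tens x (Tens y z)))
          (Tens (Tens x y) z).

HB.instance Definition _ a b := gen_eqMixin (term a b).
HB.instance Definition _ a b := gen_choiceMixin (term a b).

Section HomSpace.
Variables a b : nat.

Let teqb (x y : term a b) := `[< teq x y >].

Fact teqb_refl : reflexive teqb.
Proof. by move=> x; apply/asboolP; apply: teq_refl. Qed.

Fact teqb_sym : symmetric teqb.
Proof. by move=> x y; apply/asboolP/asboolP; apply: teq_sym. Qed.

Fact teqb_trans : transitive teqb.
Proof. by move=> y x z /asboolP xy /asboolP /(teq_trans xy) ?; apply/asboolP. Qed.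

Canonical teq_equiv := EquivRel teqb teqb_refl teqb_sym teqb_trans.

Definition phom := {eq_quot teq_equiv}.
HB.instance Definition _ := Choice.on phom.
HB.instance Definition _ := EqQuotient.on phom.

Definition mor (x : term a b) : phom := \pi_phom x.

Lemma morP x y : mor x = mor y <-> teq x y.
Proof. by split=> [/eqquotP /asboolP|?]; last by apply/eqquotP/asboolP. Qed.

Lemma mor_repr (f : phom) : mor (repr f) = f. Proof. exact: reprK. Qed.

Lemma repr_mor x : teq (repr (mor x)) x.
Proof. by apply/morP; rewrite mor_repr. Qed.

Lemma morW (P : phom -> Prop) : (forall x, P (mor x)) -> forall f, P f.
Proof. by move=> Px f; rewrite -[f]mor_repr. Qed.

Let padd := lock (fun f g : phom => mor (Add (repr f) (repr g))).
Let pscale := lock (fun k (f : phom) => mor (Scale k (repr f))).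
Let popp := pscale (-1).

Let paddE x y : padd (mor x) (mor y) = mor (Add x y).
Proof.
by rewrite [padd]unlock; apply/morP; apply: teq_add; apply: repr_mor.
Qed.

Let pscaleE k x : pscale k (mor x) = mor (Scale k x).
Proof.
by rewrite [pscale]unlock; apply/morP; apply: teq_scale; apply: repr_mor.
Qed.

Let paddA : associative padd.
Proof.
elim/morW=> x; elim/morW=> y; elim/morW=> z.
by rewrite !paddE; apply/morP; apply: teq_addA.
Qed.

Let paddC : commutative padd.
Proof.
by elim/morW=> x; elim/morW=> y; rewrite !paddE; apply/morP; apply: teq_addC.
Qed.

Let padd0 : left_id (mor (Zero a b)) padd.
Proof. by elim/morW=> x; rewrite !paddE; apply/morP; apply: teq_add0. Qed.

Let paddN : left_inverse (mor (Zero a b)) popp padd.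
Proof.
by elim/morW=> x; rewrite /popp pscaleE paddE; apply/morP; apply: teq_addN.
Qed.

HB.instance Definition _ := GRing.isZmodule.Build phom paddA paddC padd0 paddN.

Let pscaleA k l (f : phom) : pscale k (pscale l f) = pscale (k * l) f.
Proof. by elim/morW: f => x; rewrite !pscaleE; apply/morP; apply: teq_scaleA. Qed.

Let pscale1 : left_id 1 pscale.
Proof. by elim/morW=> x; rewrite !pscaleE; apply/morP; apply: teq_scale1. Qed.

Let pscaleDr : right_distributive pscale +%R.
Proof.
move=> k; elim/morW=> x; elim/morW=> y; rewrite /GRing.add /= !(paddE, pscaleE).
by apply/morP; apply: teq_scaleDr.
Qed.

Let pscaleDl (f : phom) : {morph pscale^~ f : k l / k + l}.
Proof.
move=> k l; elim/morW: f => x; rewrite {2}/GRing.add /= !pscaleE paddE.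
by apply/morP; apply: teq_scaleDl.
Qed.

HB.instance Definition _ :=
  GRing.Zmodule_isLmodule.Build K phom pscaleA pscale1 pscaleDr pscaleDl.

Lemma mor0 : mor (Zero a b) = 0. Proof. by []. Qed.

Lemma morD x y : mor (Add x y) = mor x + mor y.
Proof. by rewrite -paddE. Qed.

Lemma morZ k x : mor (Scale k x) = k *: mor x.
Proof. by rewrite -pscaleE. Qed.

End HomSpace.

Definition pid n : phom n n := mor (Idt n).

Definition pcomp a b c : phom b c -> phom a b -> phom a c :=
  lock (fun f g => mor (Comp (repr f) (repr g))).

Definition ptens a b c d :
    phom a b -> phom c d -> phom (a + c)%N (b + d)%N :=
  lock (fun f g => mor (Tens (repr f) (repr g))).

Lemma mor_comp a b c (x : term b c) (y : term a b) :
  mor (Comp x y) = pcomp (mor x) (mor y).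
Proof.
rewrite /pcomp unlock; apply/morP; apply: teq_sym.
by apply: teq_comp; apply: repr_mor.
Qed.

Lemma mor_tens a b c d (x : term a b) (y : term c d) :
  mor (Tens x y) = ptens (mor x) (mor y).
Proof.
rewrite /ptens unlock; apply/morP; apply: teq_sym.
by apply: teq_tens; apply: repr_mor.
Qed.

Lemma mor_cast a a' b b' (ea : a = a') (eb : b = b') (x : term a b) :
  mor (castm ea eb x) = castm (X := phom) ea eb (mor x).
Proof. by case: a' / ea; case: b' / eb. Qed.

Lemma mor_id n : mor (Idt n) = pid n. Proof. by []. Qed.

Let morE := (mor_cast, mor_id, mor_comp, mor_tens, morD, morZ).

Let pcomp1m a b (f : phom a b) :
  pcomp (pid b) f = f.
Proof.
elim/morW: f => f;
by have /morP := teq_comp1m f; rewrite !morE.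
Qed.

Let pcompm1 a b (f : phom a b) :
  pcomp f (pid a) = f.
Proof.
elim/morW: f => f;
by have /morP := teq_compm1 f; rewrite !morE.
Qed.

Let pcompA a b c d (f : phom c d) (g : phom b c) (h : phom a b) :
  pcomp f (pcomp g h) = pcomp (pcomp f g) h.
Proof.
elim/morW: f => f; elim/morW: g => g; elim/morW: h => h;
by have /morP := teq_compA f g h; rewrite !morE.
Qed.

Let pcompPl a b c k (f f' : phom b c) (g : phom a b) :
  pcomp (k *: f + f') g = k *: pcomp f g + pcomp f' g.
Proof.
elim/morW: f => f; elim/morW: f' => f'; elim/morW: g => g;
by have /morP := teq_compPl k f f' g; rewrite !morE.
Qed.

Let pcompPr a b c k (f : phom b c) (g g' : phom a b) :
  pcomp f (k *: g + g') = k *: pcomp f g + pcomp f g'.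
Proof.
elim/morW: f => f; elim/morW: g => g; elim/morW: g' => g';
by have /morP := teq_compPr k f g g'; rewrite !morE.
Qed.

Let ptensPl a b c d k (f f' : phom a b) (g : phom c d) :
  ptens (k *: f + f') g = k *: ptens f g + ptens f' g.
Proof.
elim/morW: f => f; elim/morW: f' => f'; elim/morW: g => g;
by have /morP := teq_tensPl k f f' g; rewrite !morE.
Qed.

Let ptensPr a b c d k (f : phom a b) (g g' : phom c d) :
  ptens f (k *: g + g') = k *: ptens f g + ptens f g'.
Proof.
elim/morW: f => f; elim/morW: g => g; elim/morW: g' => g';
by have /morP := teq_tensPr k f g g'; rewrite !morE.
Qed.

Let ptens_idm a b :
  ptens (pid a) (pid b) = pid (a + b)%N.
Proof.
by have /morP := teq_tens_idm a b; rewrite !morE.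
Qed.

Let ptens_comp a b c a' b' c' (f : phom b c) (g : phom a b)
    (f' : phom b' c') (g' : phom a' b') :
  ptens (pcomp f g) (pcomp f' g') = pcomp (ptens f f') (ptens g g').
Proof.
elim/morW: f => f; elim/morW: g => g; elim/morW: f' => f'; elim/morW: g' => g';
by have /morP := teq_tens_comp f g f' g'; rewrite !morE.
Qed.

Let ptens1m a b (f : phom a b) :
  ptens (pid 0) f = f.
Proof.
elim/morW: f => f;
by have /morP := teq_tens1m f; rewrite !morE.
Qed.

Let ptensm1 a b (f : phom a b) :
  castm (X := phom) (addn0 a) (addn0 b) (ptens f (pid 0)) = f.
Proof.
elim/morW: f => f;
by have /morP := teq_tensm1 f; rewrite !morE.
Qed.

Let ptensA a b c a' b' c' (f : phom a a') (g : phom b b') (h : phom c c') :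
  castm (X := phom) (addnA a b c) (addnA a' b' c') (ptens f (ptens g h))
    = ptens (ptens f g) h.
Proof.
elim/morW: f => f; elim/morW: g => g; elim/morW: h => h;
by have /morP := teq_tensA f g h; rewrite !morE.
Qed.

Definition presented : linmoncat K :=
  @LinMonCat K phom pid pcomp ptens pcomp1m pcompm1 pcompA pcompPl pcompPr
    ptensPl ptensPr ptens_idm ptens_comp ptens1m ptensm1 ptensA.

Definition pmor a b (x : term a b) : mhom presented a b := mor x.

Lemma pmor_rel a b (x y : term a b) : rel x y -> pmor x = pmor y.
Proof. by move=> r; apply/morP/teq_rel. Qed.

Lemma pmor0 a b : pmor (Zero a b) = 0. Proof. by []. Qed.

Lemma pmorD a b (x y : term a b) : pmor (Add x y) = pmor x + pmor y.
Proof. exact: morD. Qed.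

Lemma pmorZ a b k (x : term a b) : pmor (Scale k x) = k *: pmor x.
Proof. exact: morZ. Qed.

Lemma pmor_id n : pmor (Idt n) = idm n. Proof. by []. Qed.

Lemma pmor_comp a b c (x : term b c) (y : term a b) :
  pmor (Comp x y) = mcomp (pmor x) (pmor y).
Proof. exact: mor_comp. Qed.

Lemma pmor_tens a b c d (x : term a b) (y : term c d) :
  pmor (Tens x y) = mtens (pmor x) (pmor y).
Proof. exact: mor_tens. Qed.

End Presentation.

Arguments Gen {K G a b}.
Arguments Idt {K G} n.
Arguments Comp {K G a b c}.
Arguments Tens {K G a b c d}.
Arguments Zero {K G} a b.
Arguments Add {K G a b}.
Arguments Scale {K G a b}.
Arguments mor {K G} rel {a b}.
Arguments pmor {K G} rel {a b}.

Declare Scope term_scope.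
Delimit Scope term_scope with term.
Bind Scope term_scope with term.
Notation "f ∘ g" := (Comp f g) : term_scope.
Notation "f ⊗ g" := (Tens f g) : term_scope.
Notation "k *: f" := (Scale k f) : term_scope.

Record tensor_ideal (K : fieldType) (C : linmoncat K) := TensorIdeal {
  in_ideal :> forall a b, mhom C a b -> Prop;
  ideal0 : forall a b, in_ideal (0 : mhom C a b);
  idealP : forall a b k (f g : mhom C a b),
    in_ideal f -> in_ideal g -> in_ideal (k *: f + g);
  ideal_compl : forall a b c (f : mhom C b c) (g : mhom C a b),
    in_ideal f -> in_ideal (mcomp f g);
  ideal_compr : forall a b c (f : mhom C b c) (g : mhom C a b),
    in_ideal g -> in_ideal (mcomp f g);
  ideal_tensl : forall a b c d (f : mhom C a b) (g : mhom C c d),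
    in_ideal f -> in_ideal (mtens f g);
  ideal_tensr : forall a b c d (f : mhom C a b) (g : mhom C c d),
    in_ideal g -> in_ideal (mtens f g)
}.

Section Quotient.
Variables (K : fieldType) (C : linmoncat K) (J : tensor_ideal C).

Lemma idealD a b (f g : mhom C a b) : J _ _ f -> J _ _ g -> J _ _ (f + g).
Proof. by move=> Jf Jg; rewrite -[f]scale1r; apply: idealP. Qed.

Lemma idealZ a b k (f : mhom C a b) : J _ _ f -> J _ _ (k *: f).
Proof.
by move=> Jf; rewrite -[_ *: _]addr0; apply: idealP => //; apply: ideal0.
Qed.

Lemma mcompBl a b c (f f' : mhom C b c) (g : mhom C a b) :
  mcomp (f - f') g = mcomp f g - mcomp f' g.
Proof. by rewrite addrC -scaleN1r mcompPl scaleN1r addrC. Qed.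

Lemma mcompBr a b c (f : mhom C b c) (g g' : mhom C a b) :
  mcomp f (g - g') = mcomp f g - mcomp f g'.
Proof. by rewrite addrC -scaleN1r mcompPr scaleN1r addrC. Qed.

Lemma mtensBl a b c d (f f' : mhom C a b) (g : mhom C c d) :
  mtens (f - f') g = mtens f g - mtens f' g.
Proof. by rewrite addrC -scaleN1r mtensPl scaleN1r addrC. Qed.

Lemma mtensBr a b c d (f : mhom C a b) (g g' : mhom C c d) :
  mtens f (g - g') = mtens f g - mtens f g'.
Proof. by rewrite addrC -scaleN1r mtensPr scaleN1r addrC. Qed.

Section HomSpace.
Variables a b : nat.

Let jeqb (f g : mhom C a b) := `[< J _ _ (f - g) >].

Fact jeqb_refl : reflexive jeqb.
Proof. by move=> f; apply/asboolP; rewrite subrr; apply: ideal0. Qed.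

Fact jeqb_sym : symmetric jeqb.
Proof.
by move=> f g; apply/asboolP/asboolP => /(idealZ (-1)); rewrite scaleN1r opprB.
Qed.

Fact jeqb_trans : transitive jeqb.
Proof.
move=> g f h /asboolP fg /asboolP /(idealD fg).
by rewrite subrKA => ?; apply/asboolP.
Qed.

Canonical jeq_equiv := EquivRel jeqb jeqb_refl jeqb_sym jeqb_trans.

Definition qhom := {eq_quot jeq_equiv}.
HB.instance Definition _ := Choice.on qhom.
HB.instance Definition _ := EqQuotient.on qhom.

Definition quo (f : mhom C a b) : qhom := \pi_qhom f.

Lemma quoP f g : quo f = quo g <-> J _ _ (f - g).
Proof. by split=> [/eqquotP /asboolP|?]; last by apply/eqquotP/asboolP. Qed.

Lemma quo_repr (f : qhom) : quo (repr f) = f. Proof. exact: reprK. Qed.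

Lemma repr_quo f : J _ _ (repr (quo f) - f).
Proof. by apply/quoP; rewrite quo_repr. Qed.

Lemma quoW (P : qhom -> Prop) : (forall x, P (quo x)) -> forall f, P f.
Proof. by move=> Px f; rewrite -[f]quo_repr. Qed.

Let qadd := lock (fun f g : qhom => quo (repr f + repr g)).
Let qscale := lock (fun k (f : qhom) => quo (k *: repr f)).
Let qopp := qscale (-1).

Let qaddE f g : qadd (quo f) (quo g) = quo (f + g).
Proof.
rewrite [qadd]unlock; apply/quoP; rewrite opprD addrACA.
by apply: idealD; apply: repr_quo.
Qed.

Let qscaleE k f : qscale k (quo f) = quo (k *: f).
Proof.
by rewrite [qscale]unlock; apply/quoP; rewrite -scalerBr; apply/idealZ/repr_quo.
Qed.

Let qaddA : associative qadd.
Proof. by elim/quoW=> f; elim/quoW=> g; elim/quoW=> h; rewrite !qaddE addrA. Qed.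

Let qaddC : commutative qadd.
Proof. by elim/quoW=> f; elim/quoW=> g; rewrite !qaddE addrC. Qed.

Let qadd0 : left_id (quo 0) qadd.
Proof. by elim/quoW=> f; rewrite !qaddE add0r. Qed.

Let qaddN : left_inverse (quo 0) qopp qadd.
Proof. by elim/quoW=> f; rewrite /qopp qscaleE qaddE scaleN1r addNr. Qed.

HB.instance Definition _ := GRing.isZmodule.Build qhom qaddA qaddC qadd0 qaddN.

Let qscaleA k l (f : qhom) : qscale k (qscale l f) = qscale (k * l) f.
Proof. by elim/quoW: f => f; rewrite !qscaleE scalerA. Qed.

Let qscale1 : left_id 1 qscale.
Proof. by elim/quoW=> f; rewrite !qscaleE scale1r. Qed.

Let qscaleDr : right_distributive qscale +%R.
Proof.
move=> k; elim/quoW=> f; elim/quoW=> g.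
rewrite -[quo f + quo g]/(qadd _ _) -[RHS]/(qadd _ _).
by rewrite !(qaddE, qscaleE) scalerDr.
Qed.

Let qscaleDl (f : qhom) : {morph qscale^~ f : k l / k + l}.
Proof.
move=> k l; elim/quoW: f => f.
by rewrite -[RHS]/(qadd _ _) !qscaleE qaddE scalerDl.
Qed.

HB.instance Definition _ :=
  GRing.Zmodule_isLmodule.Build K qhom qscaleA qscale1 qscaleDr qscaleDl.

Lemma quoD f g : quo (f + g) = quo f + quo g. Proof. by rewrite -qaddE. Qed.

Lemma quoZ k f : quo (k *: f) = k *: quo f. Proof. by rewrite -qscaleE. Qed.

End HomSpace.

Definition qid n : qhom n n := quo (idm n).

Definition qcomp a b c : qhom b c -> qhom a b -> qhom a c :=
  lock (fun f g => quo (mcomp (repr f) (repr g))).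

Definition qtens a b c d :
    qhom a b -> qhom c d -> qhom (a + c)%N (b + d)%N :=
  lock (fun f g => quo (mtens (repr f) (repr g))).

Lemma quo_comp a b c (f : mhom C b c) (g : mhom C a b) :
  quo (mcomp f g) = qcomp (quo f) (quo g).
Proof.
rewrite /qcomp unlock; apply/esym/quoP.
rewrite -(subrKA (mcomp f (repr (quo g)))) -mcompBl -mcompBr.
by apply: idealD; [apply: ideal_compl | apply: ideal_compr]; apply: repr_quo.
Qed.

Lemma quo_tens a b c d (f : mhom C a b) (g : mhom C c d) :
  quo (mtens f g) = qtens (quo f) (quo g).
Proof.
rewrite /qtens unlock; apply/esym/quoP.
rewrite -(subrKA (mtens f (repr (quo g)))) -mtensBl -mtensBr.
by apply: idealD; [apply: ideal_tensl | apply: ideal_tensr]; apply: repr_quo.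
Qed.

Lemma quo_cast a a' b b' (ea : a = a') (eb : b = b') (f : mhom C a b) :
  quo (castm (X := mhom C) ea eb f) = castm (X := qhom) ea eb (quo f).
Proof. by case: a' / ea; case: b' / eb. Qed.

Lemma quo_id n : quo (idm n) = qid n. Proof. by []. Qed.

Let quoE := (quo_cast, quo_id, quo_comp, quo_tens, quoD, quoZ).

Let qcomp1m a b (f : qhom a b) :
  qcomp (qid b) f = f.
Proof.
elim/quoW: f => f;
by have /(congr1 (fun h => quo h)) := mcomp1m f; rewrite !quoE.
Qed.

Let qcompm1 a b (f : qhom a b) :
  qcomp f (qid a) = f.
Proof.
elim/quoW: f => f;
by have /(congr1 (fun h => quo h)) := mcompm1 f; rewrite !quoE.
Qed.

Let qcompA a b c d (f : qhom c d) (g : qhom b c) (h : qhom a b) :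
  qcomp f (qcomp g h) = qcomp (qcomp f g) h.
Proof.
elim/quoW: f => f; elim/quoW: g => g; elim/quoW: h => h;
by have /(congr1 (fun h => quo h)) := mcompA f g h; rewrite !quoE.
Qed.

Let qcompPl a b c k (f f' : qhom b c) (g : qhom a b) :
  qcomp (k *: f + f') g = k *: qcomp f g + qcomp f' g.
Proof.
elim/quoW: f => f; elim/quoW: f' => f'; elim/quoW: g => g;
by have /(congr1 (fun h => quo h)) := mcompPl k f f' g; rewrite !quoE.
Qed.

Let qcompPr a b c k (f : qhom b c) (g g' : qhom a b) :
  qcomp f (k *: g + g') = k *: qcomp f g + qcomp f g'.
Proof.
elim/quoW: f => f; elim/quoW: g => g; elim/quoW: g' => g';
by have /(congr1 (fun h => quo h)) := mcompPr k f g g'; rewrite !quoE.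
Qed.

Let qtensPl a b c d k (f f' : qhom a b) (g : qhom c d) :
  qtens (k *: f + f') g = k *: qtens f g + qtens f' g.
Proof.
elim/quoW: f => f; elim/quoW: f' => f'; elim/quoW: g => g;
by have /(congr1 (fun h => quo h)) := mtensPl k f f' g; rewrite !quoE.
Qed.

Let qtensPr a b c d k (f : qhom a b) (g g' : qhom c d) :
  qtens f (k *: g + g') = k *: qtens f g + qtens f g'.
Proof.
elim/quoW: f => f; elim/quoW: g => g; elim/quoW: g' => g';
by have /(congr1 (fun h => quo h)) := mtensPr k f g g'; rewrite !quoE.
Qed.

Let qtens_idm a b :
  qtens (qid a) (qid b) = qid (a + b)%N.
Proof.
by have /(congr1 (fun h => quo h)) := mtens_idm C a b; rewrite !quoE.
Qed.

Let qtens_comp a b c a' b' c' (f : qhom b c) (g : qhom a b)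
    (f' : qhom b' c') (g' : qhom a' b') :
  qtens (qcomp f g) (qcomp f' g') = qcomp (qtens f f') (qtens g g').
Proof.
elim/quoW: f => f; elim/quoW: g => g; elim/quoW: f' => f'; elim/quoW: g' => g';
by have /(congr1 (fun h => quo h)) := mtens_comp f g f' g'; rewrite !quoE.
Qed.

Let qtens1m a b (f : qhom a b) :
  qtens (qid 0) f = f.
Proof.
elim/quoW: f => f;
by have /(congr1 (fun h => quo h)) := mtens1m f; rewrite !quoE.
Qed.

Let qtensm1 a b (f : qhom a b) :
  castm (X := qhom) (addn0 a) (addn0 b) (qtens f (qid 0)) = f.
Proof.
elim/quoW: f => f;
by have /(congr1 (fun h => quo h)) := mtensm1 f; rewrite !quoE.
Qed.

Let qtensA a b c a' b' c' (f : qhom a a') (g : qhom b b') (h : qhom c c') :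
  castm (X := qhom) (addnA a b c) (addnA a' b' c') (qtens f (qtens g h))
    = qtens (qtens f g) h.
Proof.
elim/quoW: f => f; elim/quoW: g => g; elim/quoW: h => h;
by have /(congr1 (fun h => quo h)) := mtensA f g h; rewrite !quoE.
Qed.

Definition quotient : linmoncat K :=
  @LinMonCat K qhom qid qcomp qtens qcomp1m qcompm1 qcompA qcompPl qcompPr
    qtensPl qtensPr qtens_idm qtens_comp qtens1m qtensm1 qtensA.

Definition proj a b (f : mhom C a b) : mhom quotient a b := quo f.

Lemma projP a b (f g : mhom C a b) : proj f = proj g <-> J _ _ (f - g).
Proof. exact: quoP. Qed.

Lemma projD a b (f g : mhom C a b) : proj (f + g) = proj f + proj g.
Proof. exact: quoD. Qed.

Lemma projZ a b k (f : mhom C a b) : proj (k *: f) = k *: proj f.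
Proof. exact: quoZ. Qed.

Lemma proj_id n : proj (idm n) = idm n. Proof. by []. Qed.

Lemma proj_comp a b c (f : mhom C b c) (g : mhom C a b) :
  proj (mcomp f g) = mcomp (proj f) (proj g).
Proof. exact: quo_comp. Qed.

Lemma proj_tens a b c d (f : mhom C a b) (g : mhom C c d) :
  proj (mtens f g) = mtens (proj f) (proj g).
Proof. exact: quo_tens. Qed.

End Quotient.

Arguments proj {K C} J {a b}.

Definition is_basis (K : fieldType) (V : lmodType K) (b : seq V) : Prop :=
  (forall c : 'I_(size b) -> K,
     \sum_(i < size b) c i *: b`_i = 0 -> forall i, c i = 0)
  /\ (forall v : V, exists c : 'I_(size b) -> K,
     v = \sum_(i < size b) c i *: b`_i).

(* The field Q(q). *)
Definition Qq : fieldType := {fraction {poly rat}}.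
Definition q : Qq := tofrac 'X.

Definition qint (n : nat) : Qq := (q ^+ n - q ^- n) / (q - q^-1).

Definition tau : Qq := q ^+ 12.
Definition beta : Qq := q ^+ 24.

Inductive Tgen : nat -> nat -> Type :=
  | gen_m : Tgen 2 1
  | gen_sp : Tgen 2 2
  | gen_sm : Tgen 2 2
  | gen_cup : Tgen 0 2
  | gen_cap : Tgen 2 0.

Section TRelations.
Local Notation tm := (term Qq Tgen).
Local Open Scope term_scope.

Let one : tm 1 1 := Idt 1.
Let m : tm 2 1 := Gen gen_m.
Let sp : tm 2 2 := Gen gen_sp.
Let sm : tm 2 2 := Gen gen_sm.
Let cup : tm 0 2 := Gen gen_cup.
Let cap : tm 2 0 := Gen gen_cap.
Let s : tm 1 2 := (one ⊗ m) ∘ (cup ⊗ one).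

Variables delta phi : Qq.

Inductive Trel : forall a b, tm a b -> tm a b -> Prop :=
  | R1l : @Trel 1 1 ((cap ⊗ one) ∘ (one ⊗ cup)) one
  | R1r : @Trel 1 1 ((one ⊗ cap) ∘ (cup ⊗ one)) one
  | R2 : @Trel 1 2 ((one ⊗ m) ∘ (cup ⊗ one)) ((m ⊗ one) ∘ (one ⊗ cup))
  | R3l : @Trel 3 1 ((one ⊗ cap) ∘ (sm ⊗ one)) ((cap ⊗ one) ∘ (one ⊗ sp))
  | R3r : @Trel 3 1 ((one ⊗ cap) ∘ (sp ⊗ one)) ((cap ⊗ one) ∘ (one ⊗ sm))
  | R4l : @Trel 2 2 (sm ∘ sp) (Idt 2)
  | R4r : @Trel 2 2 (sp ∘ sm) (Idt 2)
  | R5 : @Trel 3 3 ((sp ⊗ one) ∘ (one ⊗ sp) ∘ (sp ⊗ one))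
                   ((one ⊗ sp) ∘ (sp ⊗ one) ∘ (one ⊗ sp))
  | R6 : @Trel 3 2 ((one ⊗ m) ∘ (sp ⊗ one) ∘ (one ⊗ sp)) (sp ∘ (m ⊗ one))
  | R7 : @Trel 2 3 ((one ⊗ sp) ∘ (sp ⊗ one) ∘ (one ⊗ s)) ((s ⊗ one) ∘ sp)
  | R8_cap : @Trel 2 0 (cap ∘ sp) (beta *: cap)
  | R8_m : @Trel 2 1 (m ∘ sp) (tau *: m)
  | R8_ms : @Trel 1 1 (m ∘ s) (phi *: one)
  | R8_dim : @Trel 0 0 (cap ∘ cup) (delta *: Idt 0)
  | R8_mcup : @Trel 0 1 (m ∘ cup) (Zero 0 1).

End TRelations.

Section TMorphisms.
Variables delta phi : Qq.

Definition catT : linmoncat Qq := presented (Trel delta phi).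

Local Notation gen g := (pmor (Trel delta phi) (Gen g)).

Definition Tm : mhom catT 2 1 := gen gen_m.
Definition Tsp : mhom catT 2 2 := gen gen_sp.
Definition Tsm : mhom catT 2 2 := gen gen_sm.
Definition Tcup : mhom catT 0 2 := gen gen_cup.
Definition Tcap : mhom catT 2 0 := gen gen_cap.

Local Open Scope mor_scope.

Let one : mhom catT 1 1 := idm 1.

Definition Ts : mhom catT 1 2 := (one ⊗ Tm) ∘ (Tcup ⊗ one).

Definition TU : mhom catT 2 2 := Tcup ∘ Tcap.
Definition TH : mhom catT 2 2 := (Tm ⊗ one) ∘ (one ⊗ Ts).
Definition TN : mhom catT 2 2 := Ts ∘ Tm.
Definition TXp : mhom catT 2 2 :=
  q ^+ 6 *: ((Tm ⊗ one) ∘ (one ⊗ Tsp) ∘ (Ts ⊗ one) : mhom catT 2 2)%mor.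
Definition TXm : mhom catT 2 2 :=
  q ^- 6 *: ((Tm ⊗ one) ∘ (one ⊗ Tsm) ∘ (Ts ⊗ one) : mhom catT 2 2)%mor.

End TMorphisms.

(* Main.v *)
(** The standing assumption gives X_+ = a 1 + a' U + b H + b' N + c sigma_+ for
    some scalars, and a quarter turn turns this into
    X_- = a' 1 + a U + b' H + b N + c sigma_-.  Sliding strands through the
    trivalent vertices shows sigma_+ H = q^6 X_+ and sigma_- H = q^-6 X_-.
    Comparing coefficients in sigma_- X_+ = q^-6 H then gives b b' = 1 and
    b^3 = -q^-6; as 1 is the only cube root of 1 in Q(q), b = -q^-2, and
    a = q^-8 c, a' = q^8 c follow.

    The value of c comes from the skein relation with z1 = z2 = z.  Composed with
    m it gives m H = t m with q^12 - q^-12 = z (1 + t - phi).  Composed with H it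
    expresses z H^2; as H^2 is invariant under a quarter turn, subtracting the
    rotated equation eliminates it and leaves
    (q^6 + q^-6)(X_+ - X_-) = z phi (1 - U) + z (1 + t) (H - N). *)

Require Import Defs.
From mathcomp Require Import all_boot all_algebra.
From mathcomp Require Import ring lra.

Set Implicit Arguments.
Unset Strict Implicit.
Unset Printing Implicit Defensive.

Import GRing.Theory Num.Theory.
Local Open Scope ring_scope.

(** * Strict monoidal categories *)

Section StrictMonoidal.
Variables (K : fieldType) (C : linmoncat K).
Local Open Scope mor_scope.

Lemma mcompZl a b c k (f : mhom C b c) (g : mhom C a b) :
  (k *: f) ∘ g = k *: (f ∘ g).
Proof. by rewrite -[k *: f]addr0 mcompPl -(subrr f) mcompBl subrr addr0. Qed.

Lemma mcompZr a b c k (f : mhom C b c) (g : mhom C a b) :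
  f ∘ (k *: g) = k *: (f ∘ g).
Proof. by rewrite -[k *: g]addr0 mcompPr -(subrr g) mcompBr subrr addr0. Qed.

Lemma mcompDl a b c (f f' : mhom C b c) (g : mhom C a b) :
  (f + f') ∘ g = f ∘ g + f' ∘ g.
Proof. by rewrite -[f]scale1r mcompPl !scale1r. Qed.

Lemma mcompDr a b c (f : mhom C b c) (g g' : mhom C a b) :
  f ∘ (g + g') = f ∘ g + f ∘ g'.
Proof. by rewrite -[g]scale1r mcompPr !scale1r. Qed.

Lemma mcomp0l a b c (g : mhom C a b) : (0 : mhom C b c) ∘ g = 0.
Proof. by rewrite -[0](scale0r (0 : mhom C b c)) mcompZl scale0r. Qed.

Lemma mcomp0r a b c (f : mhom C b c) : f ∘ (0 : mhom C a b) = 0.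
Proof. by rewrite -[0](scale0r (0 : mhom C a b)) mcompZr scale0r. Qed.

Lemma mtensZl a b c d k (f : mhom C a b) (g : mhom C c d) :
  (k *: f) ⊗ g = k *: (f ⊗ g).
Proof. by rewrite -[k *: f]addr0 mtensPl -(subrr f) mtensBl subrr addr0. Qed.

Lemma mtensZr a b c d k (f : mhom C a b) (g : mhom C c d) :
  f ⊗ (k *: g) = k *: (f ⊗ g).
Proof. by rewrite -[k *: g]addr0 mtensPr -(subrr g) mtensBr subrr addr0. Qed.

Lemma mtensDl a b c d (f f' : mhom C a b) (g : mhom C c d) :
  (f + f') ⊗ g = f ⊗ g + f' ⊗ g.
Proof. by rewrite -[f]scale1r mtensPl !scale1r. Qed.

Lemma mtensDr a b c d (f : mhom C a b) (g g' : mhom C c d) :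
  f ⊗ (g + g') = f ⊗ g + f ⊗ g'.
Proof. by rewrite -[g]scale1r mtensPr !scale1r. Qed.

Lemma mcomp_tensl a b c d (f : mhom C b c) (g : mhom C a b) :
  (f ∘ g) ⊗ idm d = (f ⊗ idm d) ∘ (g ⊗ idm d).
Proof. by rewrite -mtens_comp mcomp1m. Qed.

Lemma mcomp_tensr a b c d (f : mhom C b c) (g : mhom C a b) :
  idm d ⊗ (f ∘ g) = (idm d ⊗ f) ∘ (idm d ⊗ g).
Proof. by rewrite -mtens_comp mcomp1m. Qed.

Lemma mtens_exchange a b c d (f : mhom C a b) (g : mhom C c d) :
  (f ⊗ idm d) ∘ (idm a ⊗ g) = (idm b ⊗ g) ∘ (f ⊗ idm c).
Proof. by rewrite -!mtens_comp !mcomp1m !mcompm1. Qed.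

(* For numerals the two equations hold by computation, and castm disappears. *)
Lemma mtensA_cast a b c a' b' c' (f : mhom C a a') (g : mhom C b b')
    (h : mhom C c c') (ea : (a + (b + c) = a + b + c)%N)
    (eb : (a' + (b' + c') = a' + b' + c')%N) :
  castm (X := mhom C) ea eb (f ⊗ (g ⊗ h)) = f ⊗ g ⊗ h.
Proof.
by rewrite -mtensA (eq_irrelevance ea (addnA a b c))
           (eq_irrelevance eb (addnA a' b' c')).
Qed.

Lemma idm_idm_tens k l a b (f : mhom C a b) (ea : (k + (l + a) = k + l + a)%N)
    (eb : (k + (l + b) = k + l + b)%N) :
  castm (X := mhom C) ea eb (idm k ⊗ (idm l ⊗ f)) = idm (k + l) ⊗ f.
Proof. by rewrite -mtens_idm mtensA_cast. Qed.

Lemma tens_idm_idm a b k l (f : mhom C a b) (ea : (a + (k + l) = a + k + l)%N)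
    (eb : (b + (k + l) = b + k + l)%N) :
  (f ⊗ idm k) ⊗ idm l = castm (X := mhom C) ea eb (f ⊗ idm (k + l)).
Proof. by rewrite -mtens_idm mtensA_cast. Qed.

Lemma idm_tens_idm k l a b (f : mhom C a b) (ea : (k + (a + l) = k + a + l)%N)
    (eb : (k + (b + l) = k + b + l)%N) :
  (idm k ⊗ f) ⊗ idm l = castm (X := mhom C) ea eb (idm k ⊗ (f ⊗ idm l)).
Proof. by rewrite mtensA_cast. Qed.

Lemma mtensm1_cast a b (f : mhom C a b) (ea : (a + 0 = a)%N)
    (eb : (b + 0 = b)%N) : castm (X := mhom C) ea eb (f ⊗ idm 0) = f.
Proof.
by rewrite (eq_irrelevance ea (addn0 a)) (eq_irrelevance eb (addn0 b)) mtensm1.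
Qed.

Lemma idm_idm11 a b (f : mhom C a b) :
  idm 1 ⊗ (idm 1 ⊗ f) = idm 2 ⊗ f :> mhom C (2 + a) (2 + b).
Proof. exact: (idm_idm_tens (k := 1) (l := 1) f erefl erefl). Qed.

Lemma idm_idm12 a b (f : mhom C a b) :
  idm 1 ⊗ (idm 2 ⊗ f) = idm 3 ⊗ f :> mhom C (3 + a) (3 + b).
Proof. exact: (idm_idm_tens (k := 1) (l := 2) f erefl erefl). Qed.

Lemma idm_idm21 a b (f : mhom C a b) :
  idm 2 ⊗ (idm 1 ⊗ f) = idm 3 ⊗ f :> mhom C (3 + a) (3 + b).
Proof. exact: (idm_idm_tens (k := 2) (l := 1) f erefl erefl). Qed.

Lemma idm_tens1 a b r (f : mhom C a b) :
  (idm 1 ⊗ f) ⊗ idm r = idm 1 ⊗ (f ⊗ idm r)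
    :> mhom C (1 + (a + r)) (1 + (b + r)).
Proof. exact: (idm_tens_idm (k := 1) f erefl erefl). Qed.

Lemma tens_idm22 k l (f : mhom C 2 2) :
  (f ⊗ idm k) ⊗ idm l = f ⊗ idm (k + l) :> mhom C (2 + (k + l)) (2 + (k + l)).
Proof. exact: (tens_idm_idm (k := k) (l := l) f erefl erefl). Qed.

Lemma tens_idm21 k l (f : mhom C 2 1) :
  (f ⊗ idm k) ⊗ idm l = f ⊗ idm (k + l) :> mhom C (2 + (k + l)) (1 + (k + l)).
Proof. exact: (tens_idm_idm (k := k) (l := l) f erefl erefl). Qed.

Lemma tens_idm12 k l (f : mhom C 1 2) :
  (f ⊗ idm k) ⊗ idm l = f ⊗ idm (k + l) :> mhom C (1 + (k + l)) (2 + (k + l)).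
Proof. exact: (tens_idm_idm (k := k) (l := l) f erefl erefl). Qed.

Lemma tens_idm02 k l (f : mhom C 0 2) :
  (f ⊗ idm k) ⊗ idm l = f ⊗ idm (k + l) :> mhom C (0 + (k + l)) (2 + (k + l)).
Proof. exact: (tens_idm_idm (k := k) (l := l) f erefl erefl). Qed.

Lemma tens_idm20 k l (f : mhom C 2 0) :
  (f ⊗ idm k) ⊗ idm l = f ⊗ idm (k + l) :> mhom C (2 + (k + l)) (0 + (k + l)).
Proof. exact: (tens_idm_idm (k := k) (l := l) f erefl erefl). Qed.

(** Normal form for whiskered morphisms: [idm k ⊗ (f ⊗ idm r)], with adjacent identity strands
    merged. *)
Definition flat := (idm_idm11, idm_idm12, idm_idm21, idm_tens1,
  tens_idm22, tens_idm21, tens_idm12, tens_idm02, tens_idm20).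

End StrictMonoidal.

(** * Diagrams with trivalent vertices and crossings *)

Section Diagrams.
Variables (K : fieldType) (C : linmoncat K).
Variables (m : mhom C 2 1) (sp sm : mhom C 2 2) (cup : mhom C 0 2)
  (cap : mhom C 2 0) (beta tau phi : K).
Local Open Scope mor_scope.
Local Notation I1 := (idm 1).
Local Notation I2 := (idm 2).
Variables (s : mhom C 1 2) (H : mhom C 2 2).
Local Notation tens_idm0 f := (mtensm1_cast f erefl erefl : f ⊗ idm 0 = f).

(** * Bent strands and quarter turns *)

Hypotheses (zigL : (cap ⊗ I1) ∘ (I1 ⊗ cup) = I1 :> mhom C 1 1)
  (zigR : (I1 ⊗ cap) ∘ (cup ⊗ I1) = I1 :> mhom C 1 1)
  (s_l : s = (I1 ⊗ m) ∘ (cup ⊗ I1) :> mhom C 1 2)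
  (s_r : s = (m ⊗ I1) ∘ (I1 ⊗ cup) :> mhom C 1 2)
  (H_l : H = (m ⊗ I1) ∘ (I1 ⊗ s) :> mhom C 2 2).

Lemma cap_exchange_r (f : mhom C 2 1) :
  (I1 ⊗ cap) ∘ (f ⊗ I2) = f ∘ (I2 ⊗ cap) :> mhom C 4 1.
Proof. by rewrite -[f in RHS](tens_idm0 f) (mtens_exchange f cap). Qed.

Lemma cap_exchange_l (f : mhom C 2 1) :
  (cap ⊗ I1) ∘ (I2 ⊗ f) = f ∘ (cap ⊗ I2) :> mhom C 4 1.
Proof. by rewrite (mtens_exchange cap f) mtens1m. Qed.

(** In the form [s_r], the leg closed by [cap] comes from [cup]; the zigzag straightens and leaves
    [m]. *)
Lemma m_cap_s : (I1 ⊗ cap) ∘ (s ⊗ I1) = m :> mhom C 2 1.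
Proof.
rewrite s_r mcomp_tensl !flat mcompA cap_exchange_r.
by rewrite -mcompA -flat -mcomp_tensr zigR mtens_idm mcompm1.
Qed.

Lemma cap_m_s : (cap ⊗ I1) ∘ (I1 ⊗ s) = m :> mhom C 2 1.
Proof.
rewrite s_l mcomp_tensr !flat mcompA cap_exchange_l.
by rewrite -mcompA -(tens_idm20 1 1 cap) -(idm_tens1 1 cup)
  -(mcomp_tensl 1 (cap ⊗ I1) (I1 ⊗ cup)) zigL mtens_idm mcompm1.
Qed.

(** With each [m] written as a bent [s], both forms are two copies of [s] joined by a [cap], created
    in either order. *)
Lemma H_r : H = (I1 ⊗ m) ∘ (s ⊗ I1) :> mhom C 2 2.
Proof.
rewrite H_l -[m in LHS]m_cap_s -[m in RHS]cap_m_s mcomp_tensl mcomp_tensr.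
by rewrite !flat -!mcompA (mtens_exchange s s).
Qed.

(* The second morphism is the first one rotated by a quarter turn. *)
Definition rotated (f g : mhom C 2 2) : Prop :=
  (I1 ⊗ cap) ∘ (f ⊗ I1) = (cap ⊗ I1) ∘ (I1 ⊗ g) :> mhom C 3 1.

Lemma zigzag_r : (I1 ⊗ (cap ⊗ I1)) ∘ (cup ⊗ I2) = I2 :> mhom C 2 2.
Proof.
rewrite -(idm_tens1 1 cap) -(tens_idm02 1 1 cup).
by rewrite -(mcomp_tensl 1 (I1 ⊗ cap) (cup ⊗ I1)) zigR mtens_idm.
Qed.

Lemma zigzag_l : (I1 ⊗ (cap ⊗ I1)) ∘ (I2 ⊗ cup) = I2 :> mhom C 2 2.
Proof.
rewrite -(idm_idm11 cup).
by rewrite -(mcomp_tensr 1 (cap ⊗ I1) (I1 ⊗ cup)) zigL mtens_idm.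
Qed.

(** Bending the left leg back with [cup] cancels the [cap] over [g], so the quarter turn of [f] is
    determined by [f]. *)
Lemma rotatedE f g : rotated f g ->
  g = (I1 ⊗ ((I1 ⊗ cap) ∘ (f ⊗ I1) : mhom C 3 1)) ∘ (cup ⊗ I2).
Proof.
rewrite /rotated => ->; rewrite mcomp_tensr !flat -mcompA.
by rewrite -(mtens_exchange cup g) mtens1m mcompA zigzag_r mcomp1m.
Qed.

Lemma rotated_inj f g g' : rotated f g -> rotated f g' -> g = g'.
Proof. by move=> /rotatedE -> /rotatedE ->. Qed.

Lemma rotatedD f g f' g' :
  rotated f g -> rotated f' g' -> rotated (f + f') (g + g').
Proof. by rewrite /rotated mtensDl mtensDr !mcompDr => -> ->. Qed.

Lemma rotatedZ k f g : rotated f g -> rotated (k *: f) (k *: g).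
Proof. by rewrite /rotated mtensZl mtensZr !mcompZr => ->. Qed.

Lemma rotated_idm : rotated I2 (cup ∘ cap).
Proof.
rewrite /rotated mtens_idm mcompm1 mcomp_tensr mcompA.
by rewrite zigL mcomp1m.
Qed.

Lemma rotated_U : rotated (cup ∘ cap) I2.
Proof.
rewrite /rotated mtens_idm mcompm1 mcomp_tensl mcompA.
by rewrite zigR mcomp1m.
Qed.

Lemma cap_tens_H : (cap ⊗ I1) ∘ (I1 ⊗ H) = m ∘ (m ⊗ I1) :> mhom C 3 1.
Proof.
rewrite H_r mcomp_tensr !flat mcompA cap_exchange_l -mcompA.
rewrite -(tens_idm20 1 1 cap) -(idm_tens1 1 s).
by rewrite -(mcomp_tensl 1 (cap ⊗ I1) (I1 ⊗ s)) cap_m_s.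
Qed.

Lemma rotated_N : rotated (s ∘ m) H.
Proof. by rewrite /rotated cap_tens_H mcomp_tensl mcompA m_cap_s. Qed.

Lemma rotated_H : rotated H (s ∘ m).
Proof.
rewrite /rotated mcomp_tensr mcompA cap_m_s H_l mcomp_tensl !flat.
rewrite mcompA cap_exchange_r -mcompA.
by rewrite -(idm_idm11 cap) -(mcomp_tensr 1 (I1 ⊗ cap) (s ⊗ I1)) m_cap_s.
Qed.

(** For a crossing this is X_+ or X_- without its power of q; for [s ∘ m] it is [H ∘ H]. *)
Let Y (f : mhom C 2 2) : mhom C 2 2 := (m ⊗ I1) ∘ (I1 ⊗ f) ∘ (s ⊗ I1).

(** Both closures reduce to [m ∘ (m ⊗ I1) ∘ (I1 ⊗ g)]. *)
Lemma rotated_Y f g : rotated f g -> rotated (Y f) (H ∘ g).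
Proof.
move=> fg; rewrite /rotated mcomp_tensr mcompA cap_tens_H /Y !mcomp_tensl !flat.
rewrite !mcompA cap_exchange_r -(idm_idm11 cap) -(mcompA m).
rewrite -(mcomp_tensr 1 (I1 ⊗ cap) (f ⊗ I1)) fg mcomp_tensr !flat.
rewrite -!mcompA -(mtens_exchange s g) -(idm_tens1 1 cap) -(tens_idm12 1 1 s).
rewrite (mcompA ((I1 ⊗ cap) ⊗ I1)).
by rewrite -(mcomp_tensl 1 (I1 ⊗ cap) (s ⊗ I1)) m_cap_s.
Qed.

(** * Crossings sliding past cups, caps and vertices *)

Section Braiding.
Hypotheses (rot_sp : rotated sp sm) (rot_sm : rotated sm sp)
  (sm_spK : sm ∘ sp = I2) (sp_smK : sp ∘ sm = I2)
  (sp_ml : (I1 ⊗ m) ∘ (sp ⊗ I1) ∘ (I1 ⊗ sp) = sp ∘ (m ⊗ I1) :> mhom C 3 2)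
  (sp_sr : (I1 ⊗ sp) ∘ (sp ⊗ I1) ∘ (I1 ⊗ s) = (s ⊗ I1) ∘ sp :> mhom C 2 3)
  (tau_neq0 : tau != 0) (beta_tau : beta = tau ^+ 2)
  (cap_sp : cap ∘ sp = beta *: cap) (m_sp : m ∘ sp = tau *: m)
  (m_s : m ∘ s = phi *: I1) (m_cup : m ∘ cup = 0).

(** The quarter turn read on cups instead of caps. With [X] denoting [f] with its right output bent
    down, both sides become [X] fed by two cups created in either order. *)
Lemma rotated_cup f g : rotated f g ->
  (I1 ⊗ f) ∘ (cup ⊗ I1) = (g ⊗ I1) ∘ (I1 ⊗ cup) :> mhom C 1 3.
Proof.
move=> /rotatedE ->; set X : mhom C 3 1 := _ ∘ (f ⊗ I1).
have fX : f = (X ⊗ I1) ∘ (I2 ⊗ cup) :> mhom C 2 2.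
  rewrite mcomp_tensl !flat -mcompA (mtens_exchange f cup) mcompA zigzag_l.
  by rewrite mcomp1m (tens_idm0 f).
rewrite mcomp_tensl !flat -!mcompA.
have := mtens_exchange cup (I1 ⊗ cup); rewrite mtens1m => ->.
rewrite mcompA -(idm_tens1 1 X) idm_idm21 -(idm_idm12 cup).
by rewrite {1}fX mcomp_tensr !flat.
Qed.

(** By the zigzag, bending one leg down is injective, so [f] can be recognised from an endomorphism
    of one strand. *)
Lemma cup_unique (f : mhom C 0 2) k :
  (cap ⊗ I1) ∘ (I1 ⊗ f) = k *: I1 :> mhom C 1 1 -> f = k *: cup.
Proof.
move=> fk.
rewrite -[f]mcomp1m -zigzag_r -mcompA -[f]mtens1m (mtens_exchange cup f) mcompA.
rewrite -(idm_idm11 f) -(mcomp_tensr 1 (cap ⊗ I1) (I1 ⊗ f)) fk.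
rewrite mtensZr mcompZl mtens_idm mcomp1m.
by rewrite -[cup in RHS](tens_idm0 cup).
Qed.

(** Two quarter turns carry the crossing from [cup] to [cap], where [cap_sp] applies. *)
Lemma sp_cup : sp ∘ cup = beta *: cup.
Proof.
apply: cup_unique; rewrite mcomp_tensr mcompA -rot_sm -mcompA.
rewrite -(rotated_cup rot_sp) mcompA -(mcomp_tensr 1 cap sp) cap_sp.
by rewrite mtensZr mcompZl zigR.
Qed.

(** This is [sp_sr] with a leg of [s] bent down to form [m]: under the [cap], [rot_sm] turns one
    [sp] into [sm], which cancels another [sp]. *)
Lemma sp_mr : sp ∘ (I1 ⊗ m) = (m ⊗ I1) ∘ (I1 ⊗ sp) ∘ (sp ⊗ I1) :> mhom C 3 2.
Proof.
rewrite -[m in RHS]m_cap_s.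
rewrite mcomp_tensl !flat -(mcompA _ (s ⊗ _)) (mtens_exchange s sp).
rewrite -(tens_idm12 1 1 s) -!mcompA -(mcomp_tensl 1 (s ⊗ I1) sp) -sp_sr.
rewrite !mcomp_tensl !flat -(idm_idm11 sp) !mcompA.
rewrite -(mcomp_tensr 1 (cap ⊗ I1) (I1 ⊗ sp)) -rot_sm.
rewrite -(mcomp_tensr 1 _ (sp ⊗ I1)) -(mcompA (I1 ⊗ cap)).
rewrite -(mcomp_tensl 1 sm sp) sm_spK.
rewrite mtens_idm mcompm1 idm_idm11.
have := mtens_exchange sp cap; rewrite (tens_idm0 sp) => <-.
rewrite -mcompA -(idm_idm11 cap) -(mcomp_tensr 1 (I1 ⊗ cap) (s ⊗ I1)).
by rewrite m_cap_s.
Qed.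

(** Obtained from [sp_ml] by moving all crossings to the opposite side. *)
Lemma sm_mr : sm ∘ (I1 ⊗ m) = (m ⊗ I1) ∘ (I1 ⊗ sm) ∘ (sm ⊗ I1) :> mhom C 3 2.
Proof.
have spsm : (sp ⊗ I1) ∘ (I1 ⊗ sp) ∘ ((I1 ⊗ sm) ∘ (sm ⊗ I1)) = idm 3
      :> mhom C 3 3.
  rewrite -mcompA (mcompA (I1 ⊗ sp)) -(mcomp_tensr 1 sp sm) sp_smK.
  by rewrite mtens_idm mcomp1m -(mcomp_tensl 1 sp sm) sp_smK mtens_idm.
rewrite -[I1 ⊗ m]mcompm1 -spsm.
rewrite (mcompA (I1 ⊗ m)) (mcompA (I1 ⊗ m)) sp_ml.
by rewrite !mcompA sm_spK mcomp1m.
Qed.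

Lemma m_sm : m ∘ sm = tau^-1 *: m.
Proof.
apply: (scalerI tau_neq0); rewrite scalerA divff // scale1r.
by rewrite -mcompZl -m_sp -mcompA sp_smK mcompm1.
Qed.

(** Sliding through the vertex leaves a factor [beta] from the cup and [tau^-1] from [m]; their
    product is [tau]. *)
Lemma sp_s : sp ∘ s = tau *: s.
Proof.
rewrite {1}s_l mcompA sp_mr -(mcompA _ (sp ⊗ I1)).
rewrite -(mcomp_tensl 1 sp cup) sp_cup.
rewrite mtensZl mcompZr -mcompA (rotated_cup rot_sp) mcompA.
rewrite -(mcomp_tensl 1 m sm) m_sm mtensZl mcompZl -s_r scalerA beta_tau.
by rewrite expr2 mulfK.
Qed.

Lemma sm_s : sm ∘ s = tau^-1 *: s.
Proof.
apply: (scalerI tau_neq0); rewrite scalerA divff // scale1r.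
by rewrite -mcompZr -sp_s mcompA sm_spK mcomp1m.
Qed.

Lemma sp_H : sp ∘ H = tau *: Y sp.
Proof.
rewrite H_r mcompA sp_mr -(mcompA _ (sp ⊗ I1)) -(mcomp_tensl 1 sp s) sp_s.
by rewrite mtensZl mcompZr.
Qed.

Lemma sm_H : sm ∘ H = tau^-1 *: Y sm.
Proof.
rewrite H_r mcompA sm_mr -(mcompA _ (sm ⊗ I1)) -(mcomp_tensl 1 sm s) sm_s.
by rewrite mtensZl mcompZr.
Qed.

(** Needed on this side because [rotated_Y] produces [H ∘ sm], which must be recognised as a
    multiple of X_-. *)
Lemma H_sm : H ∘ sm = tau^-1 *: Y sm.
Proof.
(* This is [sp_sr] with its crossings inverted. *)
have s_sm : (I1 ⊗ s) ∘ sm = (sm ⊗ I1) ∘ ((I1 ⊗ sm) ∘ (s ⊗ I1)) :> mhom C 2 3.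
  rewrite -[s ⊗ I1]mcompm1 -[idm (1 + 1)]sp_smK (mcompA (s ⊗ I1)) -sp_sr.
  rewrite !mcompA -(mcompA (sm ⊗ I1)) -(mcomp_tensr 1 sm sp) sm_spK.
  rewrite mtens_idm mcompm1 -(mcomp_tensl 1 sm sp) sm_spK.
  by rewrite mtens_idm mcomp1m.
rewrite H_l -mcompA s_sm mcompA -(mcomp_tensl 1 m sm) m_sm mtensZl mcompZl.
by rewrite /Y mcompA.
Qed.

(** Bending [m] around the [cap] stacks it on [s] and forms the bubble [m ∘ s]. *)
Lemma cap_H : cap ∘ H = phi *: cap.
Proof.
rewrite H_l -[m in LHS]cap_m_s mcomp_tensl !flat !mcompA.
have := mtens_exchange cap cap; rewrite mtens1m (tens_idm0 cap) => <-.
rewrite -!mcompA -(idm_idm11 cap) (mcompA (I1 ⊗ (I1 ⊗ cap))).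
rewrite -(mcomp_tensr 1 (I1 ⊗ cap) (s ⊗ I1)) m_cap_s.
rewrite -(mcomp_tensr 1 m s) m_s.
by rewrite mtensZr mcompZr mtens_idm mcompm1.
Qed.

(** * Coefficients of the crossed H-diagrams *)

Variable q : K.
Hypotheses (q_tau : tau = q ^+ 12) (q_neq0 : q != 0).

Let U : mhom C 2 2 := cup ∘ cap.
Let N : mhom C 2 2 := s ∘ m.
Let Xp : mhom C 2 2 := q ^+ 6 *: Y sp.
Let Xm : mhom C 2 2 := q ^- 6 *: Y sm.

(* sigma_- takes the place of the basis vector sigma_+ + sigma_-. *)
Let lc (x1 x2 x3 x4 x5 : K) : mhom C 2 2 :=
  x1 *: I2 + x2 *: U + x3 *: H + x4 *: N + x5 *: sm.

Lemma lcD x1 x2 x3 x4 x5 y1 y2 y3 y4 y5 :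
  lc x1 x2 x3 x4 x5 + lc y1 y2 y3 y4 y5
    = lc (x1 + y1) (x2 + y2) (x3 + y3) (x4 + y4) (x5 + y5).
Proof.
rewrite /lc !scalerDl addrACA; congr (_ + _); rewrite addrACA; congr (_ + _).
by rewrite addrACA; congr (_ + _); rewrite addrACA.
Qed.

Lemma lcZ k x1 x2 x3 x4 x5 :
  k *: lc x1 x2 x3 x4 x5 = lc (k * x1) (k * x2) (k * x3) (k * x4) (k * x5).
Proof. by rewrite /lc !scalerDr !scalerA. Qed.

Lemma sp_H_X : sp ∘ H = q ^+ 6 *: Xp.
Proof. by rewrite sp_H /Xp scalerA -exprD q_tau. Qed.

Lemma sm_H_X : sm ∘ H = q ^- 6 *: Xm.
Proof. by rewrite sm_H /Xm scalerA -invfM -exprD q_tau. Qed.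

Lemma sm_Xp : sm ∘ Xp = q ^- 6 *: H.
Proof.
rewrite -[Xp](scalerK (expf_neq0 6 q_neq0)) -sp_H_X mcompZr mcompA sm_spK.
by rewrite mcomp1m.
Qed.

Lemma rotated_X : rotated Xp Xm.
Proof.
have -> : Xm = q ^+ 6 *: (H ∘ sm).
  by rewrite H_sm /Xm scalerA q_tau; congr (_ *: _); field.
exact/rotatedZ/rotated_Y.
Qed.

(** * Coordinates of X_+ and X_- *)

Hypothesis span : forall f, exists x1 x2 x3 x4 x5,
  f = x1 *: I2 + x2 *: U + x3 *: H + x4 *: N + x5 *: (sp + sm) :> mhom C 2 2.
Hypothesis free : forall x1 x2 x3 x4 x5,
  x1 *: I2 + x2 *: U + x3 *: H + x4 *: N + x5 *: (sp + sm) = 0 :> mhom C 2 2 ->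
  [/\ x1 = 0, x2 = 0, x3 = 0, x4 = 0 & x5 = 0].
Hypothesis two_neq0 : 2%:R != 0 :> K.
Hypothesis cbrt1 : forall x : K, x ^+ 3 = 1 -> x = 1.
Hypothesis q_not_root1 : forall n, (0 < n)%N -> q ^+ n != 1.
Variable z : K.
Hypothesis skein : sp - sm = z *: (I2 - U) + z *: (H - N).

Lemma sp_lc : sp = lc z (- z) z (- z) 1.
Proof.
rewrite -[sp](subrK sm) skein /lc scale1r; congr (_ + _).
by rewrite !scalerBr !scaleNr addrA.
Qed.

Lemma lc_I2 : I2 = lc 1 0 0 0 0.
Proof. by rewrite /lc !scale0r scale1r !addr0. Qed.

Lemma lc_U : U = lc 0 1 0 0 0.
Proof. by rewrite /lc !scale0r scale1r !addr0 add0r. Qed.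

Lemma lc_H : H = lc 0 0 1 0 0.
Proof. by rewrite /lc !scale0r scale1r !addr0 !add0r. Qed.

Lemma lc_N : N = lc 0 0 0 1 0.
Proof. by rewrite /lc !scale0r scale1r !addr0 !add0r. Qed.

Lemma lc_sm : sm = lc 0 0 0 0 1.
Proof. by rewrite /lc !scale0r scale1r !add0r. Qed.

(* Turns identities in End(I^2) into identities between coordinates. *)
Definition lcE := (lc_I2, lc_U, lc_H, lc_N, lc_sm, sp_lc, lcZ, lcD).

Lemma lc_inj x1 x2 x3 x4 x5 y1 y2 y3 y4 y5 :
  lc x1 x2 x3 x4 x5 = lc y1 y2 y3 y4 y5 ->
  [/\ x1 = y1, x2 = y2, x3 = y3, x4 = y4 & x5 = y5].
Proof.
move=> xy; pose d := x5 - y5.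
(* Twice the difference of the two sides, expanded with 2 [sm] = ([sp] + [sm]) - ([sp] - [sm]); the
   skein relation contributes the terms [d * z]. *)
have /free[] : (2%:R * (x1 - y1) - d * z) *: I2 + (2%:R * (x2 - y2) + d * z) *: U
    + (2%:R * (x3 - y3) - d * z) *: H + (2%:R * (x4 - y4) + d * z) *: N
    + d *: (sp + sm) = 0 :> mhom C 2 2.
  rewrite -[RHS](scaler0 _ 2%:R) -(subrr (lc y1 y2 y3 y4 y5)) -{1}xy -scaleN1r.
  by rewrite !lcE /d; congr lc; ring.
move=> e1 e2 e3 e4 d0; move: e1 e2 e3 e4; rewrite d0 !mul0r !subr0 !addr0.
have eq0 (x y : K) : 2%:R * (x - y) = 0 -> x = y.
  by move/eqP; rewrite mulf_eq0 (negPf two_neq0) subr_eq0 => /eqP.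
by do 4 move/eq0->; rewrite (subr0_eq d0).
Qed.

Lemma Xp_expand : exists a a' b b' c,
  Xp = a *: I2 + a' *: U + b *: H + b' *: N + c *: sp.
Proof.
have [x1 [x2 [x3 [x4 [x5 ->]]]]] := span Xp.
(* From [sp] + [sm] = 2 [sp] - ([sp] - [sm]) and the skein relation. *)
exists (x1 - x5 * z), (x2 + x5 * z), (x3 - x5 * z), (x4 + x5 * z), (2%:R * x5).
rewrite !lcE; congr lc; ring.
Qed.

Lemma Xm_expand a a' b b' c :
  Xp = a *: I2 + a' *: U + b *: H + b' *: N + c *: sp ->
  Xm = a' *: I2 + a *: U + b' *: H + b *: N + c *: sm.
Proof.
move=> eXp; apply: (rotated_inj rotated_X); rewrite eXp.
have -> : a' *: I2 + a *: U + b' *: H + b *: N + c *: sm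
    = a *: U + a' *: I2 + b *: N + b' *: H + c *: sm.
  by rewrite !lcE; congr lc; ring.
by do !apply: rotatedD; apply: rotatedZ; first [exact: rotated_idm
  | exact: rotated_U | exact: rotated_H | exact: rotated_N | exact: rot_sp].
Qed.

Lemma sm_U : sm ∘ U = q ^- 24 *: U.
Proof.
have beta_q : beta = q ^+ 24 by rewrite beta_tau q_tau -exprM.
have q24 := expf_neq0 24 q_neq0.
apply: (scalerI q24); rewrite scalerA divff // scale1r -beta_q.
by rewrite /U -mcompZr -mcompZl -sp_cup !mcompA sm_spK mcomp1m.
Qed.

Lemma sm_N : sm ∘ N = q ^- 12 *: N.
Proof. by rewrite /N mcompA sm_s mcompZl q_tau. Qed.

Lemma Xp_coefs a a' b b' c :
  Xp = a *: I2 + a' *: U + b *: H + b' *: N + c *: sp ->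
  [/\ a = q ^- 8 * c, a' = q ^+ 8 * c, b = - q ^- 2 & b' = - q ^+ 2].
Proof.
move=> eXp; have eXm := Xm_expand eXp.
have := sm_Xp.
rewrite {1}eXp !mcompDr !mcompZr mcompm1 sm_U sm_H_X sm_N sm_spK eXm.
rewrite !lcE => /lc_inj[].
(* Along [I2], [H], [N], [sm] the coordinates say: q^-6 b a' + c = 0, q^-6 b b' = q^-6, q^-6 b^2 +
   q^-12 b' = 0, a + q^-6 b c = 0. *)
rewrite !(mulr0, mulr1, addr0, add0r) => e1 _ e3 e4 e5.
have bb' : b * b' = 1.
  have q6 : q ^- 6 != 0 by rewrite invr_neq0 // expf_neq0.
  by apply: (mulfI q6); rewrite mulr1 -[RHS]e3; ring.
have eb : - (b * q ^+ 2) = 1.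
  apply: cbrt1.
  (* Multiplying the [N] coordinate by q^12 b and using b b' = 1 gives b^3 q^6 = -1. *)
  have -> : (- (b * q ^+ 2)) ^+ 3 =
      1 - q ^+ 12 * b * (b * (q ^- 6 * b) + b' * q ^- 12) + (b * b' - 1).
    by field.
  by rewrite e4 bb' subrr mulr0 subr0 addr0.
have -> : b' = - q ^+ 2.
  by rewrite -[b']mul1r -eb !mulNr mulrAC bb' mul1r.
have b_q : b = - q ^- 2.
  by rewrite -[q ^- 2]mul1r -eb mulNr opprK mulfK ?expf_neq0.
split=> //; move: e1 e5; rewrite b_q => e1 e5.
  have -> : a = q ^- 8 * c + (a + - q ^- 2 * (q ^- 6 * c)) by field.
  by rewrite e5 addr0.
have -> : a' = q ^+ 8 * c - q ^+ 8 * (- q ^- 2 * (q ^- 6 * a') + c) by field.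
by rewrite e1 mulr0 subr0.
Qed.

(** * The value of the coefficient c *)

Lemma N_neq0 : N != 0.
Proof.
(* Zero is written as [sm - sm] so that [lcE] gives it coordinates. *)
apply/eqP; rewrite lc_N -(subrr sm) lc_sm -scaleN1r !lcE => /lc_inj[_ _ _ /eqP].
by rewrite mulr0 addr0 oner_eq0.
Qed.

Lemma m_neq0 : m != 0.
Proof. by apply: contraNneq N_neq0 => m0; rewrite /N m0 mcomp0r. Qed.

Lemma q_diff_neq0 n : (0 < n)%N -> q ^+ n - q ^- n != 0.
Proof.
move=> n0; rewrite subr_eq0.
apply: contraNneq (q_not_root1 (n := n + n) _) => [e|].
  by rewrite exprD {1}e mulVf ?expf_neq0.
by rewrite addn_gt0 n0.
Qed.

Lemma m_skein : (q ^+ 12 - q ^- 12) *: m = z *: m + z *: (m ∘ H - phi *: m).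
Proof.
have := congr1 (mcomp m) skein.
rewrite mcompBr m_sp m_sm q_tau -scalerBl => ->.
rewrite mcompDr !mcompZr !mcompBr mcompm1 /U /N !mcompA m_cup mcomp0l subr0.
by rewrite m_s mcompZl mcomp1m.
Qed.

Lemma z_neq0 : z != 0.
Proof.
apply/negP => /eqP z0; have := m_skein; rewrite z0 !scale0r addr0 => /eqP.
by rewrite scaler_eq0 (negPf m_neq0) (negPf (q_diff_neq0 _)).
Qed.

(** The morphism [H ∘ H] is [Y N], and [N] rotates to [H], so [rotated_Y] returns [H ∘ H]. *)
Lemma rotated_HH : rotated (H ∘ H) (H ∘ H).
Proof.
have YN : Y N = H ∘ H.
  by rewrite /Y /N mcomp_tensr [X in _ = _ ∘ X]H_r H_l !mcompA.
by rewrite -{1}YN; exact: rotated_Y rotated_N.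
Qed.

Lemma U_H : U ∘ H = phi *: U.
Proof. by rewrite /U -mcompA cap_H mcompZr. Qed.

Lemma skein_coef a a' b b' c :
  Xp = a *: I2 + a' *: U + b *: H + b' *: N + c *: sp ->
  (q ^+ 6 + q ^- 6) * (b - b' - a + a') = q ^+ 12 - q ^- 12.
Proof.
move=> eXp; have eXm := Xm_expand eXp.
(* Solves z (1 + t - phi) = q^12 - q^-12, the relation read off from [m_skein]. *)
pose t := z^-1 * (q ^+ 12 - q ^- 12) - 1 + phi.
have mH : m ∘ H = t *: m.
  apply: (scalerI z_neq0).
  have := m_skein; rewrite scalerBr addrCA => /esym/(canRL (addrK _)).
  rewrite opprB => ->; rewrite !scalerA -!scalerBl -!scalerDl.
  by congr (_ *: _); rewrite /t; field; rewrite z_neq0 q_neq0.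
have N_H : N ∘ H = t *: N by rewrite /N -mcompA mH mcompZr.
have eqH : q ^+ 6 *: Xp + (- q ^- 6) *: Xm
    = z *: H + (- (z * phi)) *: U + z *: (H ∘ H) + (- (z * t)) *: N.
  have := congr1 (fun f => f ∘ H) skein.
  rewrite mcompBl mcompDl !mcompZl !mcompBl mcomp1m sp_H_X sm_H_X U_H N_H.
  by rewrite scaleNr => ->; rewrite !scalerBr !scalerA !scaleNr !addrA.
(* A second quarter turn takes [Xm] back to [Xp], as their expansions show. *)
have rotX : rotated (q ^+ 6 *: Xp + (- q ^- 6) *: Xm)
    (q ^+ 6 *: Xm + (- q ^- 6) *: Xp).
  apply: rotatedD; apply: rotatedZ; first exact: rotated_X.
  have -> : Xp = a' *: U + a *: I2 + b' *: N + b *: H + c *: sp.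
    by rewrite eXp !lcE; congr lc; ring.
  rewrite eXm; do !apply: rotatedD; apply: rotatedZ; first [exact: rotated_idm
    | exact: rotated_U | exact: rotated_H | exact: rotated_N | exact: rot_sm].
have rotHH : rotated (q ^+ 6 *: Xp + (- q ^- 6) *: Xm)
    (z *: N + (- (z * phi)) *: I2 + z *: (H ∘ H) + (- (z * t)) *: H).
  rewrite eqH; do !apply: rotatedD; apply: rotatedZ; first [exact: rotated_H
    | exact: rotated_U | exact: rotated_HH | exact: rotated_N].
have := rotated_inj rotX rotHH; move: eqH.
(* The coordinates of [H ∘ H] stay unknown: they enter both equations equally and vanish on
   subtraction. *)
have [h1 [h2 [h3 [h4 [h5 ->]]]]] := span (H ∘ H).
rewrite eXp eXm !lcE => /lc_inj[e1 _ e3 _ _] /lc_inj[f1 _ f3 _ _].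
move: e1 e3 f1 f3; rewrite !(mulr0, mulr1, addr0, add0r) => e1 e3 f1 f3.
have {f1}e1 := congr2 (fun x y => x - y) e1 f1.
have {f3}e3 := congr2 (fun x y => x - y) e3 f3.
(* In the [H] coordinate minus the [I2] coordinate, the common contribution c z of the crossings
   cancels and z (1 + t - phi) remains. *)
have e31 := congr2 (fun x y => x - y) e3 e1.
apply: etrans (etrans _ e31) _; first by field.
by rewrite /t; field; rewrite z_neq0 q_neq0.
Qed.

Theorem skein_X (c := (q ^+ 2 - q ^- 2) / (q ^+ 4 - q ^- 4)) :
  Xp = c *: (q ^- 8 *: I2 + q ^+ 8 *: U + sp) - q ^- 2 *: H - q ^+ 2 *: N
  /\ Xm = c *: (q ^+ 8 *: I2 + q ^- 8 *: U + sm) - q ^+ 2 *: H - q ^- 2 *: N.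
Proof.
have [a [a' [b [b' [c0 eXp]]]]] := Xp_expand.
have := skein_coef eXp; have eXm := Xm_expand eXp.
have [ea ea' eb eb'] := Xp_coefs eXp.
rewrite ea ea' eb eb' => ec.
have c0E : c0 = c.
  (* A factor of (q^12 - q^-12)(q^8 - q^-8), hence nonzero. *)
  have w_neq0 : (q ^+ 6 + q ^- 6) * (q ^+ 4 + q ^- 4) != 0.
    have := mulf_neq0 (q_diff_neq0 (n := 12) isT) (q_diff_neq0 (n := 8) isT).
    apply: contraNneq => w0.
    have -> : (q ^+ 12 - q ^- 12) * (q ^+ 8 - q ^- 8)
      = (q ^+ 6 + q ^- 6) * (q ^+ 4 + q ^- 4)
        * ((q ^+ 6 - q ^- 6) * (q ^+ 4 - q ^- 4)) by field.
    by rewrite w0 mul0r.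
  (* Dividing [ec] by q^6 + q^-6 would leave (q^8 - q^-8) c0 = (q^4 + q^-4)(q^2 - q^-2). *)
  apply: (canRL (mulfK (q_diff_neq0 (n := 4) isT))); apply: (mulfI w_neq0).
  apply: subr0_eq; rewrite -[RHS](subrr (q ^+ 12 - q ^- 12)) -{1}ec.
  by field.
rewrite eXp eXm ea ea' eb eb' c0E.
by split; rewrite -!scaleN1r !lcE; congr lc; ring.
Qed.

End Braiding.

End Diagrams.

(** * The field Q(q) *)

Lemma q_not_root_of_unity n : (0 < n)%N -> q ^+ n != 1.
Proof.
move=> n0; rewrite /q -tofracXn -tofrac1 tofrac_eq.
apply/eqP => /(congr1 (fun p : {poly rat} => size p)) /eqP.
by rewrite size_polyXn size_poly1 eqSS eqn0Ngt n0.
Qed.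

(** The form u^2 + u v + v^2 is positive definite over the rationals, so [g] vanishes at every
    rational point. *)
Lemma poly_sum_sqr_eq0 (f g : {poly rat}) :
  f ^+ 2 + f * g + g ^+ 2 = 0 -> g = 0.
Proof.
move=> fg; apply/eqP; apply: contraT => g0.
have gx (x : rat) : root g x.
  have := congr1 (fun p : {poly rat} => p.[x]) fg.
  by rewrite !hornerE /root -sqrf_eq0 => e; apply/eqP; nra.
(* The roots 0, 1, ... number [size g], one more than the degree allows. *)
have := max_poly_roots (rs := [seq i%:R | i <- iota 0 (size g)]) g0.
rewrite size_map size_iota ltnn => -> //.
  by apply/allP => ? _; apply: gx.
rewrite map_inj_uniq ?iota_uniq //.
by move=> i k /eqP; rewrite eqr_nat => /eqP.
Qed.

Lemma fraction_numden (R : idomainType) (x : {fraction R}) :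
  exists n d, d != 0 /\ x * tofrac d = tofrac n.
Proof.
elim/quotW: x => x; exists \n_x, \d_x; split; first exact: denom_ratioP.
unlock tofrac; rewrite -[LHS]FracField.pi_mul; apply/eqmodP => /=.
rewrite FracField.equivfE /FracField.mulf.
by rewrite !numden_Ratio ?mulr1 ?oner_neq0 ?denom_ratioP // mulrC.
Qed.

(** Another cube root of 1 would satisfy x^2 + x + 1 = 0; clearing denominators contradicts
    [poly_sum_sqr_eq0]. *)
Lemma Qq_cbrt1 (x : Qq) : x ^+ 3 = 1 -> x = 1.
Proof.
move=> x3; apply/eqP; rewrite -subr_eq0; apply/negPn/negP => x1.
have x2 : x ^+ 2 + x + 1 = 0.
  by apply: (mulfI x1); rewrite mulr0 -(subrr 1) -{3}x3; ring.
have [f [g [g0 xg]]] := fraction_numden x.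
case/eqP: g0; apply: (poly_sum_sqr_eq0 (f := f)).
apply/eqP; rewrite -tofrac_eq0 !tofracD !tofracXn tofracM -xg.
move: (tofrac g) => G.
have -> : (x * G) ^+ 2 + x * G * G + G ^+ 2 = (x ^+ 2 + x + 1) * G ^+ 2.
  by ring.
by rewrite x2 mul0r.
Qed.

(** * Passage to the quotient category *)

(* Computes on explicit terms, so that a relation of T gives the corresponding
   identity of composite morphisms by conversion alone. *)
Fixpoint eval (K : fieldType) (G : nat -> nat -> Type) (C : linmoncat K)
    (gen : forall a b, G a b -> mhom C a b) a b (x : term K G a b) :
    mhom C a b :=
  match x in term _ _ a b return mhom C a b with
  | Gen _ _ g => gen _ _ g
  | Idt n => idm n
  | Comp _ _ _ x y => mcomp (eval gen x) (eval gen y)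
  | Tens _ _ _ _ x y => mtens (eval gen x) (eval gen y)
  | Zero _ _ => 0
  | Add _ _ x y => eval gen x + eval gen y
  | Scale _ _ k x => k *: eval gen x
  end.

Section EvalQuotient.
Variables (K : fieldType) (G : nat -> nat -> Type).
Variable rel : forall a b, term K G a b -> term K G a b -> Prop.
Variable J : tensor_ideal (presented rel).
Let gen a b (g : G a b) := proj J (pmor rel (Gen g)).

Lemma proj_eval a b (x : term K G a b) : proj J (pmor rel x) = eval gen x.
Proof.
elim: x => //= {a b}.
- by move=> a b c x <- y <-; rewrite pmor_comp proj_comp.
- by move=> a b c d x <- y <-; rewrite pmor_tens proj_tens.
- by move=> a b x <- y <-; rewrite pmorD projD.
- by move=> a b k x <-; rewrite pmorZ projZ.
Qed.

Lemma eval_rel a b (x y : term K G a b) : rel x y -> eval gen x = eval gen y.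
Proof. by move=> /pmor_rel e; rewrite -!proj_eval e. Qed.

End EvalQuotient.

Lemma is_basis5 (K : fieldType) (V : lmodType K) (b0 b1 b2 b3 b4 : V) :
  is_basis [:: b0; b1; b2; b3; b4] ->
  (forall v, exists x0 x1 x2 x3 x4,
     v = x0 *: b0 + x1 *: b1 + x2 *: b2 + x3 *: b3 + x4 *: b4) /\
  (forall x0 x1 x2 x3 x4,
     x0 *: b0 + x1 *: b1 + x2 *: b2 + x3 *: b3 + x4 *: b4 = 0 ->
     [/\ x0 = 0, x1 = 0, x2 = 0, x3 = 0 & x4 = 0]).
Proof.
case=> fr sp; split=> [v|x0 x1 x2 x3 x4 e].
  have [c ->] := sp v.
  rewrite /= !big_ord_recl big_ord0 /= addr0 !addrA.
  by do 5 eexists.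
pose x := [:: x0; x1; x2; x3; x4].
have := fr (fun i => x`_i); rewrite /= !big_ord_recl big_ord0 /= addr0 !addrA.
move=> /(_ e) x_eq0.
by split; [have := x_eq0 0 | have := x_eq0 1 | have := x_eq0 2
  | have := x_eq0 3 | have := x_eq0 4].
Qed.

Theorem lemma3p14 (delta phi : Qq) (phi_neq0 : phi != 0)
    (delta_neq1 : delta != q ^+ 4 + q ^- 4)
    (delta_neq2 : delta != - q ^+ 16 - q ^- 16)
    (J : tensor_ideal (catT delta phi))
    (basisJ : is_basis [:: proj J (idm 2); proj J (TU delta phi);
       proj J (TH delta phi); proj J (TN delta phi);
       proj J (Tsp delta phi + Tsm delta phi)])
    (z1 z2 : Qq)
    (skein : proj J (Tsp delta phi) - proj J (Tsm delta phi)
       = z1 *: (proj J (idm 2) - proj J (TU delta phi))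
         + z2 *: (proj J (TH delta phi) - proj J (TN delta phi)))
    (z1_eq_z2 : z1 = z2) :
  proj J (TXp delta phi)
    = (qint 2 / qint 4) *: (q ^- 8 *: proj J (idm 2)
                            + q ^+ 8 *: proj J (TU delta phi)
                            + proj J (Tsp delta phi))
      - q ^- 2 *: proj J (TH delta phi) - q ^+ 2 *: proj J (TN delta phi)
  /\
  proj J (TXm delta phi)
    = (qint 2 / qint 4) *: (q ^+ 8 *: proj J (idm 2)
                            + q ^- 8 *: proj J (TU delta phi)
                            + proj J (Tsm delta phi))
      - q ^+ 2 *: proj J (TH delta phi) - q ^- 2 *: proj J (TN delta phi).
Proof.
have q_neq0 : q != 0 by rewrite /q tofrac_eq0 polyX_eq0.
have -> : qint 2 / qint 4 = (q ^+ 2 - q ^- 2) / (q ^+ 4 - q ^- 4).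
  have q1 : q - q^-1 != 0.
    apply: contraNneq (q_not_root_of_unity (n := 2) isT) => /eqP.
    by rewrite subr_eq0 expr2 => /eqP {1}->; rewrite mulVf.
  by rewrite /qint invf_div mulrA divfK.
have [span free] := is_basis5 basisJ.
move: skein span free; rewrite projD {}z1_eq_z2.
rewrite /TXp /TXm !projZ.
have relE a b (x y : term Qq Tgen a b) : Trel delta phi x y -> _ :=
  @eval_rel _ _ _ J a b x y.
pose m0 := Tm delta phi; pose s0 := Ts delta phi.
pose cup0 := Tcup delta phi; pose cap0 := Tcap delta phi.
pose sp0 := Tsp delta phi; pose sm0 := Tsm delta phi.
pose m := proj J m0; pose s := proj J s0.
pose cup := proj J cup0; pose cap := proj J cap0.
pose sp := proj J sp0; pose sm := proj J sm0.
pose H := proj J (TH delta phi).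
pose J1 := @idm _ (catT delta phi) 1.
have sE : s = mcomp (mtens (idm 1) m) (mtens cup (idm 1)).
  by rewrite -(proj_tens J J1 m0) -(proj_tens J cup0 J1)
     -(proj_comp J (mtens J1 m0) (mtens cup0 J1)).
have HE : H = mcomp (mtens m (idm 1)) (mtens (idm 1) s).
  by rewrite -(proj_tens J m0 J1) -(proj_tens J J1 s0)
     -(proj_comp J (mtens m0 J1) (mtens J1 s0)).
have UE : proj J (TU delta phi) = mcomp cup cap.
  by rewrite -(proj_comp J cup0 cap0).
have NE : proj J (TN delta phi) = mcomp s m by rewrite -(proj_comp J s0 m0).
have XE (f : mhom (catT delta phi) 2 2) :
    proj J (mcomp (mcomp (mtens m0 J1) (mtens J1 f)) (mtens s0 J1))
    = mcomp (mcomp (mtens m (idm 1)) (mtens (idm 1) (proj J f)))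
        (mtens s (idm 1)).
  by rewrite -(proj_tens J m0 J1) -(proj_tens J J1 f) -(proj_tens J s0 J1)
     -(proj_comp J (mtens m0 J1) (mtens J1 f))
     -(proj_comp J (mcomp (mtens m0 J1) (mtens J1 f)) (mtens s0 J1)).
rewrite (XE sp0) (XE sm0) UE NE => skein span free.
apply: (skein_X (sp := sp) (sm := sm) (beta := beta) (tau := tau)
  (phi := phi)).
- exact: relE (R1l delta phi).
- exact: relE (R1r delta phi).
- exact: sE.
- exact: etrans sE (relE _ _ _ _ (R2 delta phi)).
- exact: HE.
(* The goals [rotated sp sm] and [rotated sm sp] unfold to the two halves of R3, second half
   first. *)
- exact: relE (R3r delta phi).
- exact: relE (R3l delta phi).
- exact: relE (R4l delta phi).
- exact: relE (R4r delta phi).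
- exact: relE (R6 delta phi).
- rewrite sE; exact: relE (R7 delta phi).
- by rewrite expf_neq0.
- by rewrite /tau /beta -exprM.
- exact: relE (R8_cap delta phi).
- exact: relE (R8_m delta phi).
- rewrite sE; exact: relE (R8_ms delta phi).
- exact: relE (R8_mcup delta phi).
- by [].
- by [].
- exact: span.
- exact: free.
- rewrite -(rmorph_nat (@tofrac {poly rat})) tofrac_eq0.
  by rewrite -polyC_natr polyC_eq0.
- exact: Qq_cbrt1.
- exact: q_not_root_of_unity.
- exact: skein.
Qed.
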